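(* Let $p(s\mid x)$ be the distribution of a $(0,\delta)$-DP mechanism (in the unbounded sense), let $p(x\mid\theta,n)$ be a distribution for $x$ where $x$ consists of $n$ i.i.d. variables, and let $p(n)$ be a (possibly improper) prior on $n\in\{1,2,\dots\}$. Let $n_0$ be a positive integer and put $\gamma=\mathbb{E}_{n\mid n_{\mathrm{dp}}=n_0}|n-n_0|$. Then $$\mathrm{TV}\big(p(s\mid\theta,n=n_0),\,p(s\mid\theta,n_{\mathrm{dp}}=n_0)\big)\le\delta\gamma ,$$ and if $p(\theta)$ is a proper prior on $\theta$, then $$\mathrm{TV}\big(p(s,\theta\mid n=n_0),\,p(s,\theta\mid n_{\mathrm{dp}}=n_0)\big)\le\delta\gamma .$$
   Context: $\mathrm{TV}(P,Q)=\sup_S|P(S)-Q(S)|$ over measurable sets $S$. Datasets are finite sequences $x\in\bigcup_{n\ge1}\mathcal{X}_1^n$; in unbounded differential privacy two datasets are neighbors if they differ by the addition or removal of one entry. A mechanism $M$ (a Markov kernel $x\mapsto p(s\mid x)$ from datasets to outputs) is $(0,\delta)$-DP if $P(M(x)\in S)\le P(M(x')\in S)+\delta$ for all neighboring $x,x'$ and all measurable $S$. Model: $\theta$ is a parameter; $n$ is the unobserved sample size; given $(\theta,n)$ the dataset $x=(x_1,\dots,x_n)$ has i.i.d. entries from a distribution depending only on $\theta$; $s\in\mathbb{R}^d$ is drawn from $p(s\mid x)$ and the privatized sample size $n_{\mathrm{dp}}$ is drawn from $p(n_{\mathrm{dp}}\mid n)$. Given $(x,n)$, $s$ and $n_{\mathrm{dp}}$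 are conditionally independent; given $n$, $n_{\mathrm{dp}}$ is independent of $(x,\theta)$. The posterior $p(n\mid n_{\mathrm{dp}}=n_0)\propto p(n_{\mathrm{dp}}=n_0\mid n)p(n)$ is assumed proper. Thus $p(s\mid\theta,n)=\int p(s\mid x)p(x\mid\theta,n)\,dx$, $p(s\mid\theta,n_{\mathrm{dp}}=n_0)=\sum_{k\ge1}p(s\mid\theta,n=k)\,p(n=k\mid n_{\mathrm{dp}}=n_0)$, $p(s,\theta\mid n=n_0)=p(\theta)p(s\mid\theta,n=n_0)$ and $p(s,\theta\mid n_{\mathrm{dp}}=n_0)=p(\theta)p(s\mid\theta,n_{\mathrm{dp}}=n_0)$. *)

(* Defs.v *)
From HB Require Import structures.
From mathcomp Require Import all_boot all_order all_algebra.
From mathcomp Require Import all_classical all_reals all_analysis.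

Set Implicit Arguments.
Unset Strict Implicit.
Unset Printing Implicit Defensive.

Import Order.TTheory GRing.Theory Num.Theory.

Local Open Scope classical_set_scope.
Local Open Scope ring_scope.
Local Open Scope ereal_scope.

(* A dataset is a nonempty finite sequence; [existT _ k t] has size [k.+1]. *)
Definition dataset (T : Type) : Type := {k : nat & k.+1.-tuple T}.

Definition dataset_seq (T : Type) (x : dataset T) : seq T := tval (projT2 x).
Coercion dataset_seq : dataset >-> seq.

(* The disjoint-union sigma-algebra: a set of datasets is measurable iff its
   part of each size is measurable in the corresponding power of [T]. *)
Definition dataset_display (d : measure_display) : measure_display.
Proof. by constructor. Qed.

Section dataset_measurable.
Context (d : measure_display) (T : measurableType d).

Definition dataset_measurable (A : set (dataset T)) : Prop :=
  forall k, measurable [set t : k.+1.-tuple T | A (existT _ k t)].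

Let dataset_measurable0 : dataset_measurable set0.
Proof. by move=> k; exact: measurable0. Qed.

Let dataset_measurableC A :
  dataset_measurable A -> dataset_measurable (~` A).
Proof. by move=> mA k; exact: measurableC (mA k). Qed.

Let dataset_measurable_bigcup (F : (set (dataset T))^nat) :
  (forall i, dataset_measurable (F i)) ->
  dataset_measurable (\bigcup_i F i).
Proof. by move=> mF k; apply: bigcup_measurable => i _; exact: mF. Qed.

HB.instance Definition _ := gen_eqMixin (dataset T).
HB.instance Definition _ := gen_choiceMixin (dataset T).
HB.instance Definition _ :=
  isPointed.Build (dataset T) (existT _ 0%N [tuple point]).
HB.instance Definition _ := @isMeasurable.Build (dataset_display d)
  (dataset T) dataset_measurable dataset_measurable0 dataset_measurableC
  dataset_measurable_bigcup.

End dataset_measurable.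

(* [y] is [x] with one entry added, at an arbitrary position. *)
Definition add_entry (T : Type) (x y : seq T) : Prop :=
  exists (s1 s2 : seq T) (a : T), x = s1 ++ s2 /\ y = s1 ++ a :: s2.

Definition neighbors (T : Type) (x x' : dataset T) : Prop :=
  add_entry x x' \/ add_entry x' x.

Definition unbounded_dp (d d' : measure_display) (T : measurableType d)
    (Y : measurableType d') (R : realType)
    (M : R.-pker (dataset T) ~> Y) (delta : R) : Prop :=
  forall x x' : dataset T, neighbors x x' ->
  forall S : set Y, measurable S -> M x S <= M x' S + delta%:E.

(* Under [Q], a dataset almost surely has [n] entries, which are identically
   distributed with law [P] and mutually independent. *)
Definition iid_sample (d : measure_display) (T : measurableType d)
    (R : realType) (n : nat) (P : {measure set T -> \bar R})
    (Q : {measure set (dataset T) -> \bar R}) : Prop :=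
  [/\ Q [set x : dataset T | size x = n] = 1,
      forall i, (i < n)%N -> forall A : set T, measurable A ->
        Q [set x : dataset T | size x = n /\ A (nth point x i)] = P A
    & forall A : 'I_n -> set T, (forall i, measurable (A i)) ->
        Q [set x : dataset T | size x = n /\ forall i : 'I_n, A i (nth point x i)] =
        \prod_(i < n) Q [set x : dataset T | size x = n /\ A i (nth point x i)]].

Definition tv_distance (d : measure_display) (T : measurableType d)
    (R : realType) (P Q : set T -> \bar R) : \bar R :=
  ereal_sup [set `|P S - Q S| | S in measurable].

(* [f] is a (pointwise nonnegative) density of [P] with respect to [nu]. *)
Definition is_density (d : measure_display) (T : measurableType d)
    (R : realType) (nu P : {measure set T -> \bar R}) (f : T -> R) : Prop :=
  [/\ measurable_fun setT f, forall y, (0 <= f y)%R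
    & forall A, measurable A -> P A = \int[nu]_(y in A) (f y)%:E].

Section posterior.
Context (R : realType).
(* [lik n y] stands for p(n_dp = y | n) and [pn n] for p(n), for [n >= 1]. *)
Variables (lik : nat -> R -> R) (pn : nat -> R).

Definition evidence (y : R) : \bar R :=
  \sum_(1 <= k <oo) (lik k y * pn k)%:E.

Definition proper_posterior (y : R) : Prop := 0 < evidence y < +oo.

Definition posterior (y : R) (n : nat) : R :=
  (lik n y * pn n / fine (evidence y))%R.

(* E [ |n - n0| | n_dp = n0 ]; may be infinite. *)
Definition posterior_abs_dev (n0 : nat) : \bar R :=
  \sum_(1 <= k <oo) (posterior n0%:R k * `|k%:R - n0%:R|)%:E.

End posterior.

Section model.
Context (d dT dY : measure_display) (X : measurableType d)
  (Theta : measurableType dT) (Y : measurableType dY) (R : realType).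
Variables (px : nat -> R.-pker Theta ~> (dataset X))
  (M : R.-pker (dataset X) ~> Y).

(* p(s | theta, n) *)
Definition s_given_n (n : nat) (theta : Theta) : set Y -> \bar R :=
  kcomp_noparam (px n) M theta.

(* p(s | theta, n_dp = y) *)
Definition s_given_ndp (lik : nat -> R -> R) (pn : nat -> R) (y : R)
    (theta : Theta) (S : set Y) : \bar R :=
  \sum_(1 <= k <oo) s_given_n k theta S * (posterior lik pn y k)%:E.

(* The law p(theta) k(s | theta) of the pair (s, theta). *)
Definition joint (ptheta : probability Theta R)
    (k : Theta -> set Y -> \bar R) (A : set (Y * Theta)) : \bar R :=
  \int[ptheta]_theta k theta (ysection A theta).

End model.

(* Main.v *)
(* The first [k] of [k + 1] i.i.d. entries form an i.i.d. sample of size [k],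
   and deleting the last entry of a dataset yields a neighbor. Writing both
   p(s | theta, n = k) and p(s | theta, n = k + 1) as integrals over the same
   sample of size [k + 1], the DP inequality holds under the integral, so
   consecutive laws differ by at most [delta] on every event. Hence the laws for
   sizes [k] and [n0] differ by at most [delta * |k - n0|], and averaging over the
   posterior of [n], then over [theta], gives both bounds. *)
Require Import Defs.
From HB Require Import structures.
From mathcomp Require Import all_boot all_order all_algebra.
From mathcomp Require Import all_classical all_reals all_analysis.
From mathcomp Require Import measurable_realfun.
Import Order.TTheory GRing.Theory Num.Theory.
Local Open Scope classical_set_scope.
Local Open Scope ring_scope.
Local Open Scope ereal_scope.

(** * Boxes determine finite measures on a finite power *)

Section tuple_measure.
Context {d : measure_display} {T : measurableType d} {R : realType} {n : nat}.

Definition tuple_box (A : 'I_n -> set T) : set (n.-tuple T) :=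
  [set t | forall i, A i (tnth t i)].

Lemma measurable_tuple_box (A : 'I_n -> set T) :
  (forall i, measurable (A i)) -> measurable (tuple_box A).
Proof.
move=> mA.
have -> : tuple_box A = \bigcap_(i in [set: 'I_n]) ((@tnth n T ^~ i) @^-1` A i).
  by apply/seteqP; split=> [t At i _|t At i]; [exact: At|exact: (At i I)].
apply: fin_bigcap_measurable => // i _.
by rewrite -[X in measurable X]setTI; exact: measurable_tnth.
Qed.

(** Boxes are stable under intersection and generate the product sigma-algebra, so the uniqueness
    theorem for finite measures applies. *)
Lemma tuple_measure_unique (mu nu : {measure set n.-tuple T -> \bar R}) :
  mu setT < +oo ->
  (forall A, (forall i, measurable (A i)) ->
    mu (tuple_box A) = nu (tuple_box A)) ->
  forall B, measurable B -> mu B = nu B.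
Proof.
move=> mufin munu B mB.
pose G := [set tuple_box A | A in [set A | forall i, measurable (A i)]].
have boxT : tuple_box (fun=> setT) = setT by apply/seteqP; split.
apply: (@measure_unique _ _ _ G (fun=> setT)) => //.
- apply/seteqP; split.
  + apply: smallest_sub; first exact: smallest_sigma_algebra.
    apply: (big_ind (fun X => X `<=` <<s G >>)) => //.
      by move=> X Y XG YG Z [/XG|/YG].
    move=> i _ _ [C mC <-]; apply: sub_sigma_algebra.
    (* The preimage of [C] under the [i]-th projection is the box whose other sides are full. *)
    exists (fun j => if j == i then C else setT).
      by move=> j /=; case: ifP.
    rewrite setTI; apply/seteqP; split=> [t /(_ i)|t Ct j]; first by rewrite eqxx.
    by case: eqP => [->|].
  + apply: smallest_sub; first exact: sigma_algebra_measurable.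
    by move=> _ [A mA <-]; exact: measurable_tuple_box.
- move=> _ _ [A mA <-] [A' mA' <-].
  exists (fun i => A i `&` A' i).
    by move=> i; exact: measurableI (mA i) (mA' i).
  apply/seteqP; split=> [t AA'|t [At A't] i]; last by split; [exact: At|exact: A't].
  by split=> i; have [] := AA' i.
- by move=> _; exists (fun=> setT) => //.
- by rewrite bigcup_const.
- by move=> _ [A mA <-]; exact: munu.
Qed.

End tuple_measure.

(** * Restriction to a set of full measure *)

Section full_set.
Context {d : measure_display} {T : measurableType d} {R : realType}.
Variable mu : {measure set T -> \bar R}.

Lemma measure_setC_eq0 S : measurable S -> mu setT = 1 -> mu S = 1 ->
  mu (~` S) = 0.
Proof.
move=> mS mu1 muS; have mufin : mu setT < +oo by rewrite mu1 ltry.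
rewrite -setTD measureD// setTI.
by rewrite -[LHS]/(mu setT - mu S) mu1 muS subee.
Qed.

Lemma measure_setI_full B S : measurable B -> measurable S ->
  mu (~` S) = 0 -> mu B = mu (B `&` S).
Proof.
move=> mB mS S0; have mSC := measurableC mS.
have BE : B = (B `&` S) `|` (B `&` ~` S) by rewrite -setIUr setUv setIT.
have BC0 : mu (B `&` ~` S) = 0.
  apply: (subset_measure0 _ mSC _ S0); first exact: measurableI.
  exact: subIsetr.
rewrite [in LHS]BE measureU.
- by rewrite -[X in _ + X]/(mu (B `&` ~` S)) BC0 adde0.
- exact: measurableI.
- exact: measurableI.
- by rewrite setIACA setICr setI0.
Qed.

End full_set.

(** * Truncation of datasets to a fixed length, and its measurability *)

Section dataset_tuple.
Context {d : measure_display} {X : measurableType d}.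

(* Datasets with fewer than [n] entries are padded with [point]. *)
Definition dataset_tuple (n : nat) (x : dataset X) : n.-tuple X :=
  [tuple nth point x i | i < n].

(** On the component of each size, the map is a coordinate projection or, past the end, the constant
    [point]. *)
Lemma measurable_dataset_nth (i : nat) :
  measurable_fun [set: dataset X] (fun x : dataset X => nth point x i).
Proof.
move=> _ B mB; rewrite setTI.
change (dataset_measurable ((fun x : dataset X => nth point x i) @^-1` B)) => k.
have [ik|ki] := ltnP i k.+1.
  have -> : [set t : k.+1.-tuple X |
      ((fun x : dataset X => nth point x i) @^-1` B) (existT _ k t)] =
      (@tnth _ X ^~ (Ordinal ik)) @^-1` B.
    by apply/funext => t; rewrite /= (tnth_nth point).
  by rewrite -[X in measurable X]setTI; exact: measurable_tnth.
have -> : [set t : k.+1.-tuple X |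
    ((fun x : dataset X => nth point x i) @^-1` B) (existT _ k t)] =
    (fun=> point) @^-1` B.
  by apply/funext => t; rewrite /= nth_default// size_tuple.
by rewrite -[X in measurable X]setTI; exact: measurable_cst.
Qed.

Lemma measurable_dataset_tuple (n : nat) :
  measurable_fun setT (dataset_tuple n).
Proof.
apply/measurable_fun_tnthP => i.
rewrite [X in measurable_fun _ X](_ : _ =
    fun x : dataset X => nth point x i); first exact: measurable_dataset_nth.
by apply/funext => x /=; rewrite tnth_mktuple.
Qed.

Lemma measurable_dataset_size (n : nat) :
  measurable [set x : dataset X | size x = n].
Proof.
change (dataset_measurable [set x : dataset X | size x = n]) => k.
have [<-|kn] := eqVneq k.+1 n.
  have -> : [set t : k.+1.-tuple X |
      [set x : dataset X | size x = k.+1] (existT _ k t)] = setT.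
    by apply/seteqP; split=> // t _ /=; rewrite size_tuple.
  exact: measurableT.
have -> : [set t : k.+1.-tuple X |
    [set x : dataset X | size x = n] (existT _ k t)] = set0.
  by apply/seteqP; split=> // t /=; rewrite size_tuple => /eqP; rewrite (negbTE kn).
exact: measurable0.
Qed.

Lemma measurable_existT_dataset (k : nat) :
  measurable_fun setT (fun t : k.+1.-tuple X => existT _ k t : dataset X).
Proof. by move=> _ B mB; rewrite setTI; exact: mB. Qed.

Lemma dataset_tuple_size (k : nat) (x : dataset X) :
  size x = k.+1 -> existT _ k (dataset_tuple k.+1 x) = x.
Proof.
case: x => j t; rewrite /= size_tuple => -[jk]; subst j; congr existT.
by apply: eq_from_tnth => i; rewrite tnth_mktuple (tnth_nth point).
Qed.

Lemma dataset_tuple_neighbors (k : nat) (x : dataset X) :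
  size x = k.+2 -> neighbors (existT _ k (dataset_tuple k.+1 x)) x.
Proof.
(* The entry added back is the last one, at index [k.+1], so the suffix after it is empty. *)
move=> sx; left; exists (dataset_tuple k.+1 x), [::], (nth point x k.+1).
split; first by rewrite cats0.
apply: (@eq_from_nth _ point); first by rewrite sx size_cat size_tuple addn1.
move=> i; rewrite sx ltnS leq_eqVlt => /predU1P[->|ik].
  by rewrite nth_cat size_tuple ltnn subnn.
by rewrite nth_cat size_tuple ik -[i]/(val (Ordinal ik)) -tnth_nth tnth_mktuple.
Qed.

End dataset_tuple.

(** * Initial segments of i.i.d. samples *)

Section iid.
Context {d : measure_display} {X : measurableType d} {R : realType}.
Variables (P : {measure set X -> \bar R}).
Hypothesis P1 : P setT = 1.
Implicit Types Q : {measure set (dataset X) -> \bar R}.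

Lemma iid_sample_size_ae m Q : Q setT = 1 -> iid_sample m P Q ->
  Q (~` [set x : dataset X | size x = m]) = 0.
Proof.
move=> Q1 [Qm _ _].
have mS := @measurable_dataset_size d X m.
exact: measure_setC_eq0.
Qed.

(** The first [n] entries of a sample of size [m] have the product law, whatever [m] is: full sides
    are given to the remaining entries, and each contributes a factor [P setT = 1]. *)
Lemma iid_sample_box m n Q (A : 'I_n -> set X) : (n <= m)%N ->
  Q setT = 1 -> iid_sample m P Q -> (forall i, measurable (A i)) ->
  Q (dataset_tuple n @^-1` tuple_box A) = \prod_(i < n) P (A i).
Proof.
move=> nm Q1 iidQ mA.
(* The sides are reindexed by natural numbers and padded with [setT] from [n] on, so that one family
   serves both ['I_n] and ['I_m]. *)
pose A' i := if insub i is Some j then A j else setT.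
have mA' i : measurable (A' i).
  by rewrite /A'; case: insubP.
have mS := @measurable_dataset_size d X m.
have mB : measurable (dataset_tuple n @^-1` tuple_box A).
  rewrite -[X in measurable X]setTI; apply: measurable_dataset_tuple => //.
  exact: measurable_tuple_box.
transitivity (Q [set x : dataset X |
    size x = m /\ forall i : 'I_m, A' i (nth point x i)]).
  rewrite (measure_setI_full _ _ _ mB mS (iid_sample_size_ae _ _ Q1 iidQ)).
  congr (Q _); apply/seteqP; split=> x.
  - move=> [Bx sx]; split=> // i; rewrite /A'.
    case: insubP => [j _ ji|//]; rewrite -ji.
    by have := Bx j; rewrite tnth_mktuple.
  - move=> [sx A'x]; split=> // i; rewrite tnth_mktuple.
    have := A'x (widen_ord nm i); rewrite /A' /=.
    by case: insubP => [j _ /val_inj ->|]; rewrite ?ltn_ord.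
case: iidQ => _ Qi QI; rewrite (QI (fun i : 'I_m => A' i))//.
under eq_bigr => i _ do rewrite Qi//.
rewrite [RHS](eq_bigr (fun i : 'I_n => P (A' i))); last first.
  by move=> i _; rewrite /A' valK.
rewrite [RHS](big_ord_widen m (fun i => P (A' i)) nm) [RHS]big_mkcond/=.
apply: eq_bigr => i _; case: ifPn => // ni.
by rewrite /A' insubN.
Qed.

(** Moves the integral from a sample of size [k.+1] to a possibly larger one: truncation pushes both
    laws to measures on [k.+1]-tuples that agree on boxes, hence everywhere. *)
Lemma iid_sample_integral k m Q Q' (f : dataset X -> \bar R) :
  (k < m)%N -> Q setT = 1 -> Q' setT = 1 ->
  iid_sample k.+1 P Q -> iid_sample m P Q' ->
  measurable_fun [set: dataset X] f -> (forall x, 0 <= f x) ->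
  \int[Q]_x f x = \int[Q']_x f (existT _ k (dataset_tuple k.+1 x)).
Proof.
move=> km Q1 Q'1 iidQ iidQ' mf f0.
pose g t : \bar R := f (existT _ k t).
have mg : measurable_fun setT g.
  exact: measurableT_comp mf (@measurable_existT_dataset _ _ k).
have mD := @measurable_dataset_tuple d X k.+1.
(* Truncating to [k.+1] entries is the identity on datasets of that size, which carry all the mass
   of [Q]. *)
have -> : \int[Q]_x f x = \int[Q]_x (g \o dataset_tuple k.+1) x.
  apply: ae_eq_integral => //; first exact: measurableT_comp.
  exists (~` [set x : dataset X | size x = k.+1]); split.
  - by apply: measurableC; exact: measurable_dataset_size.
  - exact: iid_sample_size_ae.
  - by move=> x /= nfg sx; apply: nfg => _; rewrite /g /= dataset_tuple_size.
have g0 : {in [set: k.+1.-tuple X], forall t, 0 <= g t} by move=> t _; exact: f0.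
rewrite -[LHS](@ge0_integral_pushforward _ _ _ _ _ _ mD Q setT g)//.
rewrite -[RHS](@ge0_integral_pushforward _ _ _ _ _ _ mD Q' setT g)//.
apply: eq_measure_integral => B mB _.
apply: tuple_measure_unique mB => /=; first by rewrite /pushforward preimage_setT Q1 ltry.
by move=> A mA; rewrite /pushforward (@iid_sample_box k.+1)// (@iid_sample_box m).
Qed.

End iid.

(** * Integrating inequalities against a probability measure *)

Section ae_shift.
Context {d : measure_display} {T : measurableType d} {R : realType}.
Variable mu : {measure set T -> \bar R}.
Hypothesis mu1 : mu setT = 1.

(** A constant integrates to itself under total mass 1. Nonnegativity replaces integrability, and
    [c] may be infinite, as the bound [delta * gamma] can be. *)
Lemma integral_le_ge0D (f g : T -> \bar R) (c : \bar R) :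
  measurable_fun setT f -> (forall x, 0 <= f x) ->
  measurable_fun setT g -> (forall x, 0 <= g x) -> 0 <= c ->
  {ae mu, forall x, f x <= g x + c} ->
  \int[mu]_x f x <= \int[mu]_x g x + c.
Proof.
move=> mf f0 mg g0 c0 fgc.
have -> : \int[mu]_x g x + c = \int[mu]_x (g x + c).
  rewrite ge0_integralD//; congr (_ + _).
  by rewrite integral_cst// mu1 mule1.
apply: ae_ge0_le_integral => //.
- by move=> x _; rewrite adde_ge0.
- exact: emeasurable_funD.
- by apply: filterS fgc => x fx _.
Qed.

Lemma integral_itv01 (f : T -> \bar R) : measurable_fun setT f ->
  (forall x, 0 <= f x <= 1) -> 0 <= \int[mu]_x f x <= 1.
Proof.
move=> mf f01; rewrite integral_ge0/=; last by move=> x _; case/andP: (f01 x).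
(* The upper bound is the shift inequality with [g = 0] and [c = 1]. *)
rewrite -[leRHS]add0e -[X in X + _](integral0 mu setT).
apply: integral_le_ge0D => //; first by move=> x; case/andP: (f01 x).
by apply: aeW => x; rewrite add0e; case/andP: (f01 x).
Qed.

End ae_shift.

(** The one-step estimate: both integrals are written over [Q'], where [f] is evaluated at a dataset
    and at its truncation by one entry. *)
Lemma iid_sample_integral_le {d} {X : measurableType d} {R : realType}
    (P : {measure set X -> \bar R}) (k : nat)
    (Q Q' : {measure set (dataset X) -> \bar R}) (f : dataset X -> \bar R)
    (delta : R) :
  P setT = 1 -> Q setT = 1 -> Q' setT = 1 ->
  iid_sample k.+1 P Q -> iid_sample k.+2 P Q' ->
  measurable_fun [set: dataset X] f -> (forall x, 0 <= f x) -> (0 <= delta)%R ->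
  (forall x x', neighbors x x' -> f x <= f x' + delta%:E) ->
  \int[Q]_x f x <= \int[Q']_x f x + delta%:E /\
  \int[Q']_x f x <= \int[Q]_x f x + delta%:E.
Proof.
move=> P1 Q1 Q'1 iidQ iidQ' mf f0 delta0 fD.
rewrite (iid_sample_integral _ P1 _ _ _ _ _ _ Q1 Q'1 iidQ iidQ' mf f0)//.
have mg : measurable_fun [set: dataset X]
    (fun x => f (existT _ k (dataset_tuple k.+1 x))).
  exact: (measurableT_comp (measurableT_comp mf (measurable_existT_dataset k))
    (measurable_dataset_tuple k.+1)).
(* Truncation yields a neighbor only for datasets of size exactly [k.+2], so the comparison of
   integrands holds almost everywhere. *)
have ae : {ae Q', forall x : dataset X, size x = k.+2}.
  exists (~` [set x : dataset X | size x = k.+2]); split => //.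
  - by apply: measurableC; exact: measurable_dataset_size.
  - exact: iid_sample_size_ae iidQ'.
split; apply: integral_le_ge0D => //.
- apply: filterS ae => x /dataset_tuple_neighbors; exact: fD.
- apply: filterS ae => x /dataset_tuple_neighbors xx'; apply: fD.
  by case: xx' => ?; [right|left].
Qed.

(** * Averaging a sequence with bounded increments *)

Section mixture.
Context {R : realType}.
Implicit Types (h : nat -> \bar R) (w : nat -> R) (delta : R).

(** Increments telescope: [hD] treats both directions by induction on the gap [j], and the order of
    [m] and [n] selects one of them. *)
Lemma le_nat_dist h delta : (0 <= delta)%R ->
  (forall k, (0 < k)%N ->
    h k <= h k.+1 + delta%:E /\ h k.+1 <= h k + delta%:E) ->
  forall m n, (0 < m)%N -> (0 < n)%N ->
    h m <= h n + delta%:E * `|m%:R - n%:R|%:E.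
Proof.
move=> delta0 hS.
have hD j m : (0 < m)%N -> h m <= h (m + j)%N + (delta * j%:R)%:E /\
    h (m + j)%N <= h m + (delta * j%:R)%:E.
  move=> m0; elim: j => [|j [ih1 ih2]]; first by rewrite addn0 mulr0 adde0.
  have [h1 h2] := hS (m + j)%N (ltn_addr _ m0).
  rewrite addnS -natr1 mulrDr mulr1 EFinD; split.
    by rewrite (le_trans ih1)// [X in _ <= _ + X]addeC addeA leeD2r.
  by rewrite (le_trans h2)// addeA leeD2r.
move=> m n m0 n0; rewrite -EFinM; case: (leqP m n) => [mn|/ltnW nm].
  have [+ _] := hD (n - m)%N m m0; rewrite subnKC// natrB//.
  by rewrite distrC ger0_norm// subr_ge0 ler_nat.
have [_ +] := hD (m - n)%N n n0; rewrite subnKC// natrB//.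
by rewrite ger0_norm// subr_ge0 ler_nat.
Qed.

(** Carrying the lower bound as a predicate makes [0 < k] available in the termwise side
    conditions. *)
Lemma eseries_from1 (u : nat -> \bar R) :
  \sum_(1 <= k <oo) u k = \sum_(0 <= k <oo | (0 < k)%N) u k.
Proof. by apply/congr_lim/funext => n; rewrite (big_nat_widenl _ 0%N). Qed.

(** The weights sum to 1, so [h n0] is itself the series of [h n0 * w k] and is compared with the
    mixture term by term. The mean deviation in [c] may be infinite. *)
Lemma mixture_le h w delta n0 :
  (0 <= delta)%R -> (0 < n0)%N ->
  (forall k, (0 < k)%N -> 0 <= h k <= 1) ->
  (forall k, (0 < k)%N -> (0 <= w k)%R) ->
  \sum_(1 <= k <oo) (w k)%:E = 1 ->
  (forall m n, (0 < m)%N -> (0 < n)%N ->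
    h m <= h n + delta%:E * `|m%:R - n%:R|%:E) ->
  let mix := \sum_(1 <= k <oo) h k * (w k)%:E in
  let c := delta%:E * \sum_(1 <= k <oo) (w k * `|k%:R - n0%:R|)%:E in
  [/\ h n0 <= mix + c, mix <= h n0 + c & 0 <= mix <= 1].
Proof.
move=> delta0 n0_gt0 h01 w0; rewrite !eseries_from1 => w1 hD mix c.
have h0 k : (0 < k)%N -> 0 <= h k by move=> /h01/andP[].
have hfin : h n0 \is a fin_num.
  have /andP[a b] := h01 _ n0_gt0.
  by rewrite ge0_fin_numE// (le_lt_trans b)// ltry.
have wE0 k : (0 < k)%N -> 0 <= (w k)%:E by move=> /w0; rewrite lee_fin.
have hw0 k : (0 < k)%N -> 0 <= h k * (w k)%:E.
  by move=> k0; rewrite mule_ge0 ?h0 ?wE0.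
have dw0 k : (0 < k)%N -> 0 <= (w k * `|k%:R - n0%:R|)%:E.
  by move=> k0; rewrite lee_fin mulr_ge0 ?w0.
have dwd0 k : (0 < k)%N -> 0 <= delta%:E * (w k * `|k%:R - n0%:R|)%:E.
  by move=> k0; rewrite mule_ge0 ?dw0.
have cE : c = \sum_(0 <= k <oo | (0 < k)%N)
    delta%:E * (w k * `|k%:R - n0%:R|)%:E by rewrite nneseriesZl.
have hn0E : h n0 = \sum_(0 <= k <oo | (0 < k)%N) h n0 * (w k)%:E.
  by rewrite -(fineK hfin) nneseriesZl// w1 mule1.
have hn0w k : (0 < k)%N -> 0 <= h n0 * (w k)%:E.
  by move=> k0; rewrite mule_ge0 ?h0 ?wE0.
(* Used with [(m, n)] equal to [(n0, k)] and to [(k, n0)]; the equation between distances covers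
   both orders. *)
have step m n k : (0 < m)%N -> (0 < n)%N -> (0 < k)%N ->
    `|m%:R - n%:R|%R = `|k%:R - n0%:R|%R :> R ->
    h m * (w k)%:E <= h n * (w k)%:E + delta%:E * (w k * `|k%:R - n0%:R|)%:E.
  move=> m0 n_0 k0 <-.
  rewrite (le_trans (lee_wpmul2r (wE0 _ k0) (hD _ _ m0 n_0)))//.
  rewrite muleDl//; last by rewrite ge0_adde_def// inE ?h0// mule_ge0.
  by rewrite -muleA -EFinM [X in (_ * X)%:E]mulrC.
split.
- rewrite hn0E cE -nneseriesD; [|by move=> k _; exact: hw0|by move=> k _; exact: dwd0].
  apply: lee_nneseries => [k _|k k0]; first exact: hn0w.
  by apply: step => //; rewrite distrC.
- rewrite hn0E cE -nneseriesD; [|by move=> k _; exact: hn0w|by move=> k _; exact: dwd0].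
  apply: lee_nneseries => [k _|k k0]; first exact: hw0.
  exact: step.
- rewrite nneseries_ge0//=; last by move=> k _; exact: hw0.
  rewrite -w1; apply: lee_nneseries => [k _|k k0]; first exact: hw0.
  rewrite -[leRHS]mul1e lee_wpmul2r ?wE0//.
  by case/andP: (h01 _ k0).
Qed.

End mixture.

(** The bounds by 0 and 1 make [a] and [b] real, which excludes differences of infinities; [c] may
    still be infinite. *)
Lemma abse_sub_le {R : realType} (a b c : \bar R) :
  0 <= a <= 1 -> 0 <= b <= 1 -> a <= b + c -> b <= a + c -> `|a - b| <= c.
Proof.
case: a => [a| |]; rewrite ?leye_eq ?andbF//.
case: b => [b| |]; rewrite ?leye_eq ?andbF//.
case: c => [c| |]//= _ _; rewrite ?leey// !lee_fin => ab ba.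
by rewrite ler_norml lerNl opprB !lerBlDl [(b + c)%R]addrC ba addrC.
Qed.

(** Properness makes the evidence positive and finite, so it can be factored out of the series and
    cancelled. *)
Lemma posterior_series {R : realType} (lik : nat -> R -> R) (pn : nat -> R) (y : R) :
  (forall k, (0 < k)%N -> (0 <= lik k y)%R) ->
  (forall k, (0 < k)%N -> (0 <= pn k)%R) ->
  proper_posterior lik pn y ->
  (forall k, (0 < k)%N -> (0 <= posterior lik pn y k)%R) /\
  \sum_(1 <= k <oo) (posterior lik pn y k)%:E = 1.
Proof.
move=> lik0 pn0 /andP[ev_gt0 ev_fin].
have ev0 : (0 < fine (evidence lik pn y))%R by rewrite fine_gt0 ?ev_gt0.
have evE : evidence lik pn y = (fine (evidence lik pn y))%:E.
  by rewrite fineK// gt0_fin_numE.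
split; first by move=> k k0; rewrite divr_ge0 ?mulr_ge0 ?lik0 ?pn0// ltW.
rewrite eseries_from1.
under eq_eseriesr do rewrite /posterior mulrC EFinM.
rewrite nneseriesZl; last by move=> k k0; rewrite lee_fin mulr_ge0 ?lik0 ?pn0.
by rewrite -eseries_from1 -/(evidence lik pn y) {2}evE -EFinM mulVf// gt_eqF.
Qed.

(** * Bounds and measurability for the law of the output *)

Section model.
Context {d dT dY : measure_display} {X : measurableType d}
  {Theta : measurableType dT} {Y : measurableType dY} {R : realType}.
Variables (px : nat -> R.-pker Theta ~> (dataset X))
  (M : R.-pker (dataset X) ~> Y).

Lemma s_given_n_itv01 n theta S : measurable S ->
  0 <= s_given_n px M n theta S <= 1.
Proof.
move=> mS; apply: integral_itv01.
- exact: prob_kernel.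
- exact: measurable_kernel.
- move=> x; rewrite measure_ge0/=.
  rewrite -[leRHS](prob_kernel (s := M) x).
  by apply: le_measure; rewrite ?inE.
Qed.

(** Swapping the coordinates turns the section into one along the kernel's source, where section
    measurability for finite kernels applies. *)
Lemma measurable_s_given_n_ysection n (A : set (Y * Theta)) : measurable A ->
  measurable_fun setT (fun theta => s_given_n px M n theta (ysection A theta)).
Proof.
move=> mA; pose A' := (fun p => (p.2, p.1)) @^-1` A : set (Theta * Y).
have mA' : measurable A'.
  by rewrite -[X in measurable X]setTI; exact: measurable_swap.
have := measurable_fun_xsection_finite_kernel (mkcomp_noparam (px n) M)
  (mem_set mA').
by congr measurable_fun; apply/funext => theta; congr (kcomp_noparam _ _ _ _).
Qed.

End model.

Theorem theorem4p2 (R : realType) (d dT : measure_display)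
    (X : measurableType d) (Theta : measurableType dT) (dim : nat)
    (* (0, delta)-DP mechanism p(s | x) with outputs in R^dim *)
    (delta : R) (M : R.-pker (dataset X) ~> (dim.-tuple R))
    (delta_ge0 : (0 <= delta)%R) (M_dp : unbounded_dp M delta)
    (* p(x | theta, n): n i.i.d. entries of law P theta *)
    (P : R.-pker Theta ~> X) (px : nat -> R.-pker Theta ~> (dataset X))
    (px_iid : forall (n : nat) (theta : Theta), (0 < n)%N ->
       iid_sample n (P theta) (px n theta))
    (* p(n_dp | n), with density lik n with respect to nu *)
    (nu : {measure set R -> \bar R}) (pndp : nat -> probability R R)
    (lik : nat -> R -> R)
    (lik_density : forall n : nat, (0 < n)%N -> is_density nu (pndp n) (lik n))
    (* possibly improper prior p(n) on {1, 2, ...} *)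
    (pn : nat -> R) (pn_ge0 : forall n : nat, (0 < n)%N -> (0 <= pn n)%R)
    (n0 : nat) (n0_gt0 : (0 < n0)%N)
    (post_proper : proper_posterior lik pn n0%:R) :
  let gamma := posterior_abs_dev lik pn n0 in
  (forall theta : Theta,
     tv_distance (s_given_n px M n0 theta)
                     (s_given_ndp px M lik pn n0%:R theta)
       <= delta%:E * gamma)
  /\
  (forall ptheta : probability Theta R,
     tv_distance (joint ptheta (s_given_n px M n0))
                     (joint ptheta (s_given_ndp px M lik pn n0%:R))
       <= delta%:E * gamma).
Proof.
move=> gamma.
have lik_ge0 k : (0 < k)%N -> (0 <= lik k n0%:R)%R.
  by move=> /lik_density[_ + _]; exact.
have [w_ge0 w1] := posterior_series lik pn n0%:R lik_ge0 pn_ge0 post_proper.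
(* The pointwise estimate, for each parameter and event; the second bound reuses it with an event
   that depends on [theta]. *)
have mixture theta S (mS : measurable S) :
    [/\ s_given_n px M n0 theta S <=
          s_given_ndp px M lik pn n0%:R theta S + delta%:E * gamma,
        s_given_ndp px M lik pn n0%:R theta S <=
          s_given_n px M n0 theta S + delta%:E * gamma
      & 0 <= s_given_ndp px M lik pn n0%:R theta S <= 1].
  apply: (mixture_le (fun k => s_given_n px M k theta S)) => //.
    by move=> k _; exact: s_given_n_itv01.
  (* Sizes are positive, so consecutive ones have the form [k.+1] and [k.+2]. *)
  apply: le_nat_dist => // -[//|k] _.
  apply: (iid_sample_integral_le (P theta)) => //; try exact: prob_kernel.
  - exact: px_iid.
  - exact: px_iid.
  - exact: measurable_kernel.
  - by move=> x x' xx'; exact: M_dp.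
split=> [theta|ptheta]; apply: ge_ereal_sup => _ [S mS <-].
  have [le1 le2 mix01] := mixture theta S mS.
  by apply: abse_sub_le => //; exact: s_given_n_itv01.
(* For the joint laws, the estimate is applied to the section of [S] at each [theta] and then
   integrated over the prior. *)
have mSy theta : measurable (ysection S theta) by exact: measurable_ysection.
pose f theta := s_given_n px M n0 theta (ysection S theta).
pose g theta := s_given_ndp px M lik pn n0%:R theta (ysection S theta).
have f01 theta : 0 <= f theta <= 1 by exact: s_given_n_itv01.
have g01 theta : 0 <= g theta <= 1 by case: (mixture theta _ (mSy theta)).
have f0 theta : 0 <= f theta by case/andP: (f01 theta).
have g0 theta : 0 <= g theta by case/andP: (g01 theta).
have mf : measurable_fun setT f by exact: measurable_s_given_n_ysection.
(* The mixture is a countable sum of nonnegative measurable functions of [theta]. *)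
have mg : measurable_fun setT g.
  rewrite [X in measurable_fun _ X](_ : _ = fun theta =>
      \sum_(0 <= k <oo | k \in (fun k => (0 < k)%N))
        s_given_n px M k theta (ysection S theta) *
        (posterior lik pn n0%:R k)%:E); last first.
    by apply/funext => theta; rewrite /g /s_given_ndp eseries_from1.
  apply: ge0_emeasurable_sum => k.
    by move=> theta _ k0; rewrite mule_ge0 ?lee_fin ?w_ge0.
  move=> _; apply: emeasurable_funM; last exact: measurable_cst.
  exact: measurable_s_given_n_ysection.
have c0 : 0 <= delta%:E * gamma.
  rewrite mule_ge0// /gamma /posterior_abs_dev eseries_from1 nneseries_ge0//.
  by move=> k _ k0; rewrite lee_fin mulr_ge0 ?w_ge0.
have p1 : ptheta setT = 1 := probability_setT ptheta.
apply: abse_sub_le.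
- exact: (integral_itv01 ptheta p1).
- exact: (integral_itv01 ptheta p1).
- apply: (integral_le_ge0D ptheta p1 f g) => //.
  by apply: aeW => theta; case: (mixture theta _ (mSy theta)).
- apply: (integral_le_ge0D ptheta p1 g f) => //.
  by apply: aeW => theta; case: (mixture theta _ (mSy theta)).
Qed.
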